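(* Assume conditions (i)--(iv) of the list in the context. Then, for every $s\in I$, $n\in\mathbb N$, $\boldsymbol f\in C_b(\mathbb R^d;\mathbb R^m)$ and $j\in\{1,\ldots,m\}$, $$|(\boldsymbol G_n^{\mathcal N}(t,s)\boldsymbol f)_j|\le (\boldsymbol G_n^{\mathcal N,P}(t,s)|\boldsymbol f|)_j\quad\text{in } B_n,\ \text{for every } t>s.$$
   Context: Let $d\ge1$, $m\ge 2$ and let $I$ be a right halfline (possibly $I=\mathbb R$). For smooth $\boldsymbol\zeta:\mathbb R^d\to\mathbb R^m$, $k=1,\dots,m$, $(t,x)\in I\times\mathbb R^d$, set $$(\boldsymbol{\mathcal A}(t)\boldsymbol\zeta(x))_k=\sum_{i,j=1}^dq_{ij}^k(t,x)D_{ij}\zeta_k(x)+\sum_{j=1}^db^k_j(t,x)D_j\zeta_k(x)+\sum_{h=1}^mc_{kh}(t,x)\zeta_h(x),$$ with $Q^k=(q^k_{ij})$, $C=(c_{kh})$. Let $\boldsymbol{\mathcal A}^P(t)$ be the operator obtained by replacing $C$ by $C^P=(c^P_{kh})$, where $c^P_{kk}=c_{kk}$ and $c^P_{kh}=|c_{kh}|$ for $h\ne k$. Vector inequalities are componentwise; $|\boldsymbol f|:=(|f_1|,\dots,|f_m|)$; $B_R$ is the open ball of $\mathbb R^d$ centered at $0$ with radius $R$. Conditions: (i) the coefficients $q^k_{ij}=q^k_{ji}$, $b^k_j$, $c_{kh}$ belong to $C^{\alpha/2,\alpha}_{\rm loc}(I\times\mathbb R^d)$ for some $\alpha\in(0,1)$;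 (ii) for every bounded interval $J\subset I$ and every $k$, the infimum over $J\times\mathbb R^d$ of the minimum eigenvalue $\mu^k(t,x)$ of $Q^k(t,x)$ is positive; (iii) for every bounded interval $J\subset I$ there exist a componentwise positive function $\boldsymbol\varphi_J\in C^2(\mathbb R^d;\mathbb R^m)$, blowing up componentwise as $|x|\to\infty$, and a constant $\lambda_J>0$ such that $\boldsymbol{\mathcal A}^P\boldsymbol\varphi_J\le\lambda_J\boldsymbol\varphi_J$ in $J\times\mathbb R^d$; (iv) there is no nontrivial (i.e. nonempty and proper) set $K\subset\{1,\dots,m\}$ such that $c^P_{ij}$ vanishes identically on $I\times\mathbb R^d$ for every $i\in K$ and $j\notin K$. For $R>0$, $\boldsymbol G_R^{\mathcal N}(t,s)$ (resp. $\boldsymbol G_R^{\mathcal N,P}(t,s)$), $t\ge s$, denotes the evolution operator associated with the realization of $\boldsymbol{\mathcal A}$ (resp. $\boldsymbol{\mathcal A}^P$) in $C(\overline{B_R};\mathbb R^m)$ with homogeneous Neumann boundary conditions: $\boldsymbol G_R^{\mathcal N}(\cdot,s)\boldsymbol f$ is the unique classical solution $\boldsymbol u$ of $D_t\boldsymbol u=\boldsymbol{\mathcal A}(t)\boldsymbol u$ in $(s,\infty)\times B_R$, $\partial\boldsymbol u/\partial\nu=\boldsymbol 0$ on $(s,\infty)\times\partial B_R$ ($\nu$ the outward unit normal), $\boldsymbol u(s,\cdot)=\boldsymbol f$ in $B_R$; similarly for $\boldsymbol{\mathcal A}^P$. For $\boldsymbol f\in C_b(\mathbb R^d;\mathbb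 R^m)$ these operators are applied to the restriction of $\boldsymbol f$ to $\overline{B_R}$. *)

(* Defs.v *)
From HB Require Import structures.
From mathcomp Require Import all_boot all_order all_algebra.
From mathcomp Require Import all_classical all_reals all_analysis.

Set Implicit Arguments.
Unset Strict Implicit.
Unset Printing Implicit Defensive.

Import Order.TTheory GRing.Theory Num.Theory.
Import numFieldNormedType.Exports.

Local Open Scope classical_set_scope.
Local Open Scope ring_scope.

Section Euclidean.
Context {R : realType} {d : nat}.

(* The library norm of 'rV[R]_d is the sup norm; balls, spheres and Hoelder
   conditions are taken with respect to the Euclidean norm. *)
Definition enorm (x : 'rV[R]_d) : R := Num.sqrt (\sum_i x 0 i ^+ 2).

Definition oball (r : R) : set 'rV[R]_d := [set x | enorm x < r].
Definition cball (r : R) : set 'rV[R]_d := [set x | enorm x <= r].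
Definition sphere (r : R) : set 'rV[R]_d := [set x | enorm x = r].

Definition partial (i : 'I_d) (g : 'rV[R]_d -> R) (x : 'rV[R]_d) : R :=
  'D_(delta_mx 0 i) g x.

Definition partial2 (i j : 'I_d) (g : 'rV[R]_d -> R) : 'rV[R]_d -> R :=
  partial i (partial j g).

(* 'D_v is a total function, so differentiability has to be required. *)
Definition twice_partially_derivable (g : 'rV[R]_d -> R) (x : 'rV[R]_d) :=
  (forall i, derivable g x (delta_mx 0 i)) /\
  (forall i j, derivable (partial j g) x (delta_mx 0 i)).

Definition of_class_C2 (g : 'rV[R]_d -> R) :=
  [/\ continuous g,
      forall x, twice_partially_derivable g x,
      forall i, continuous (partial i g) &
      forall i j, continuous (partial2 i j g)].

Definition of_class_C12 (D : set (R * 'rV[R]_d)) (w : R -> 'rV[R]_d -> R) :=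
  [/\ {within D, continuous (fun p => w p.1 p.2)},
      forall p, D p -> derivable (w ^~ p.2) p.1 1 /\
                       twice_partially_derivable (w p.1) p.2,
      {within D, continuous (fun p => derive1 (w ^~ p.2) p.1)},
      forall i, {within D, continuous (fun p => partial i (w p.1) p.2)} &
      forall i j, {within D, continuous (fun p => partial2 i j (w p.1) p.2)}].

Definition locally_parabolic_Hoelder (alpha : R) (I : set R)
    (g : R -> 'rV[R]_d -> R) :=
  forall K : set (R * 'rV[R]_d), compact K -> K `<=` I `*` setT ->
  exists L : R, forall p q, K p -> K q ->
    `|g p.1 p.2 - g q.1 q.2| <=
      L * (`|p.1 - q.1| `^ (alpha / 2) + enorm (p.2 - q.2) `^ alpha).

(* For a symmetric matrix of positive size the set of eigenvalues is finite
   and nonempty, so its infimum is its minimum. *)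
Definition min_eigenvalue (A : 'M[R]_d) : R := inf [set a | eigenvalue A a].

End Euclidean.

Definition right_halfline {R : realType} (I : set R) :=
  I = setT \/ exists a : R, I = `]a, +oo[%classic \/ I = `[a, +oo[%classic.

Definition bounded_subinterval {R : realType} (I J : set R) :=
  [/\ is_interval J, bounded_set J & J `<=` I].

Section System.
Context {R : realType} {d m : nat}.

Definition component (z : 'rV[R]_d -> 'rV[R]_m) (k : 'I_m) : 'rV[R]_d -> R :=
  fun x => z x 0 k.

Definition system_op (Q : 'I_m -> R -> 'rV[R]_d -> 'M[R]_d)
    (b : 'I_m -> R -> 'rV[R]_d -> 'rV[R]_d) (C : R -> 'rV[R]_d -> 'M[R]_m)
    (t : R) (z : 'rV[R]_d -> 'rV[R]_m) (x : 'rV[R]_d) : 'rV[R]_m :=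
  \row_k (\sum_i \sum_j Q k t x i j * partial2 i j (component z k) x
          + \sum_j b k t x 0 j * partial j (component z k) x
          + \sum_h C t x k h * z x 0 h).

Definition offdiag_abs (C : R -> 'rV[R]_d -> 'M[R]_m) :
    R -> 'rV[R]_d -> 'M[R]_m :=
  fun t x => \matrix_(k, h) (if h == k then C t x k h else `|C t x k h|).

Definition abs_vec (y : 'rV[R]_m) : 'rV[R]_m := map_mx Num.norm y.

Definition coef_Hoelder (I : set R) (Q : 'I_m -> R -> 'rV[R]_d -> 'M[R]_d)
    (b : 'I_m -> R -> 'rV[R]_d -> 'rV[R]_d) (C : R -> 'rV[R]_d -> 'M[R]_m) :=
  (forall k t x i j, I t -> Q k t x i j = Q k t x j i) /\
  exists alpha : R, 0 < alpha < 1 /\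
    [/\ forall k i j,
          locally_parabolic_Hoelder alpha I (fun t x => Q k t x i j),
        forall k j, locally_parabolic_Hoelder alpha I (fun t x => b k t x 0 j) &
        forall k h, locally_parabolic_Hoelder alpha I (fun t x => C t x k h)].

(* The infimum is taken in the extended reals so that an empty interval J
   imposes no condition. *)
Definition ellipticity (I : set R) (Q : 'I_m -> R -> 'rV[R]_d -> 'M[R]_d) :=
  forall (J : set R), bounded_subinterval I J -> forall k : 'I_m,
  (0 < ereal_inf [set (min_eigenvalue (Q k p.1 p.2))%:E | p in J `*` setT])%E.

Definition lyapunov (I : set R) (Q : 'I_m -> R -> 'rV[R]_d -> 'M[R]_d)
    (b : 'I_m -> R -> 'rV[R]_d -> 'rV[R]_d) (C : R -> 'rV[R]_d -> 'M[R]_m) :=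
  forall (J : set R), bounded_subinterval I J ->
  exists (phi : 'rV[R]_d -> 'rV[R]_m) (lambda : R),
    [/\ forall k, of_class_C2 (component phi k),
        forall k x, 0 < phi x 0 k,
        forall k (M : R), exists r : R, forall x, r < enorm x -> M < phi x 0 k,
        0 < lambda &
        forall t x k, J t ->
          system_op Q b (offdiag_abs C) t phi x 0 k <= lambda * phi x 0 k].

Definition irreducible_coupling (I : set R) (C : R -> 'rV[R]_d -> 'M[R]_m) :=
  ~ exists K : {set 'I_m},
      [/\ K != finset.set0, K != [set: 'I_m]%SET &
          forall i j, i \in K -> j \notin K ->
            forall t x, I t -> offdiag_abs C t x i j = 0].

(* Only the one-sided limit from inside the ball makes sense at a point of the
   boundary; the outward unit normal of the sphere of radius r at x is x / r. *)
Definition zero_normal_derivative (r : R) (z : 'rV[R]_d -> 'rV[R]_m) :=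
  forall x, sphere r x ->
    h^-1 *: (z x - z (x - h *: (r^-1 *: x))) @[h --> 0^'+] --> (0 : 'rV[R]_m).

(* Classical solutions are taken in the largest usual class: continuous on the
   closed cylinder, of class C^{1,2} in the open one, and with a normal
   derivative on the lateral boundary. *)
Definition neumann_solution (Q : 'I_m -> R -> 'rV[R]_d -> 'M[R]_d)
    (b : 'I_m -> R -> 'rV[R]_d -> 'rV[R]_d) (C : R -> 'rV[R]_d -> 'M[R]_m)
    (r s : R) (g : 'rV[R]_d -> 'rV[R]_m) (u : R -> 'rV[R]_d -> 'rV[R]_m) :=
  [/\ {within `[s, +oo[%classic `*` cball r, continuous (fun p => u p.1 p.2)} /\
      (forall k, of_class_C12 (`]s, +oo[%classic `*` oball r)
                   (fun t => component (u t) k)),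
      forall t x k, s < t -> oball r x ->
        derive1 (fun tau => u tau x 0 k) t = system_op Q b C t (u t) x 0 k,
      forall t, s < t -> zero_normal_derivative r (u t) &
      forall x, oball r x -> u s x = g x].

(* [G t s g] stands for G_r^N(t,s) g.  Elements of C(cball r; R^m) are
   represented by total functions continuous on cball r, and only the values of
   [G t s g] for s <= t and on cball r are meaningful.  Existence of G is what
   the predicate asserts; uniqueness of the classical solution (which the
   maximum principle provides) is not assumed. *)
Definition neumann_evolution (I : set R)
    (Q : 'I_m -> R -> 'rV[R]_d -> 'M[R]_d)
    (b : 'I_m -> R -> 'rV[R]_d -> 'rV[R]_d) (C : R -> 'rV[R]_d -> 'M[R]_m)
    (r : R)
    (G : R -> R -> ('rV[R]_d -> 'rV[R]_m) -> ('rV[R]_d -> 'rV[R]_m)) :=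
  forall s, I s -> forall g, {within cball r, continuous g} ->
    neumann_solution Q b C r s g (fun t => G t s g).

End System.

(* Main.v *)
Require Import Defs.
From HB Require Import structures.
From mathcomp Require Import all_boot all_order all_algebra.
From mathcomp Require Import all_classical all_reals all_analysis.
From mathcomp Require Import complex spectral ring lra.
Import Order.TTheory GRing.Theory Num.Theory.
Import numFieldNormedType.Exports.
Local Open Scope classical_set_scope.
Local Open Scope ring_scope.

(** The inequality is a weak minimum principle in disguise.  Let [u] solve the
system with coupling [C] and datum [f], let [v] solve the one with coupling
[C^P] and datum [|f|], and put [w_(+,k) = v_k + u_k], [w_(-,k) = v_k - u_k].
The claim says that all these [2m] functions are nonnegative.  They solve a
system again, and that system is cooperative: for [h != k], if [c_kh >= 0] then
[|c_kh| v_h + c_kh u_h = |c_kh| w_(+,h)], and if [c_kh < 0] the same expression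
is [|c_kh| w_(-,h)].  So each term of the coupling of [w_(+,k)] is [|c_kh|] times
one of the two unknowns carrying the index [h], a negative [c_kh] exchanging
them ([sum_doubled_coupling]).  The initial datum [|f_k| +- f_k] is nonnegative.

It remains to prove that a family of functions solving a cooperative parabolic
system with homogeneous Neumann data on a ball keeps its sign
([cooperative_supersolution_ge0]).  Damp the functions by [exp (-lam (t - s))]
and add [eps (1 + |x|^2)].  If the resulting family takes a negative value, it
has a minimum, over the index, the time interval and the closed ball, that is
negative.  The minimum is not at the initial time.  It is not on the sphere,
where the normal derivative of [eps |x|^2] is positive while the others vanish:
the added term does the work for which one would otherwise call upon the Hopf
boundary lemma.  It is not in the open ball: there the time derivative is
nonpositive, the gradient vanishes, the trace of [Q] times the Hessian is
nonnegative, and the off-diagonal couplings act with the favourable sign because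
the minimum is also a minimum over the index, so that for [lam] large,
independently of [eps], the differential inequality fails.  Letting [eps] tend
to [0] gives the result.

Two facts enter that do not concern systems.  First, if the symmetric matrix [A]
has no negative eigenvalue and the quadratic form of [H] is nonnegative, then
[tr (A H) >= 0]; this follows from the unitary diagonalization of [A] over the
complex numbers ([sym_eigenvalue_ge0_trace_ge0]).  Second, derivatives are given
only along the coordinate axes, so the second derivative test requires the chain
rule along a line, which is where continuity of the partial derivatives is used
([is_derive_gradient], [C2_jet_min]). *)

Set Implicit Arguments.
Unset Strict Implicit.

(** * Nonnegative symmetric matrices *)

Lemma Re_conj_mul_real (R : rcfType) (a h : R) (p q : R[i]) :
  complex.Re (p^*%C * a%:C%C * q * h%:C%C) =
  a * (complex.Re p * complex.Re q * h + complex.Im p * complex.Im q * h).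
Proof. by case: p => pr pi; case: q => qr qi /=; ring. Qed.

(** With [A = P^* D P] over the complex numbers, [P] unitary and [D] real, the
trace of [A H] is a combination, with the weights [D_k >= 0], of the values of
the quadratic form of [H] at the real and at the imaginary parts of the rows of
[P]; the mixed terms only contribute to the imaginary part.  The diagonal entries
of [D] are eigenvalues of [A] over the reals, because they are real roots of its
characteristic polynomial. *)
Lemma sym_eigenvalue_ge0_trace_ge0 (R : rcfType) (n : nat) (A H : 'M[R]_n) :
  A^T = A -> (forall a, eigenvalue A a -> 0 <= a) ->
  (forall v : 'I_n -> R, 0 <= \sum_i \sum_j v i * v j * H i j) ->
  0 <= \sum_i \sum_j A i j * H i j.
Proof.
move=> Asym Aeig Hpsd.
pose Ac := map_mx (real_complex R) A.
pose P := spectralmx Ac; pose D := spectral_diag Ac.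
have Areal : Ac \is a realmx.
  by apply/mxOverP => i j; rewrite mxE complex_real.
have Aherm : Ac \is hermsymmx.
  apply: realsym_hermsym Areal; apply/is_hermitianmxP.
  rewrite expr0 scale1r map_mx_id//; apply/matrixP => i j.
  by rewrite !mxE -{1}Asym mxE.
have /orthomx_spectralP Aspec := hermitian_normalmx Aherm.
rewrite -/P -/D in Aspec.
have Punit : P \in unitmx by exact: spectral_unit.
have Dreal k : D 0 k = (complex.Re (D 0 k))%:C%C.
  by have /mxOverP/(_ 0 k)/RRe_real := hermitian_spectral_diag_real Aherm.
have D0 k : 0 <= complex.Re (D 0 k).
  apply: Aeig; rewrite eigenvalue_root_char -(fmorph_root (real_complex R)).
  rewrite map_char_poly /= -Dreal -eigenvalue_root_char.
  apply/eigenvalueP; exists (row k P).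
    rewrite -/Ac {1}Aspec -row_mul !mulmxA mulmxV// mul1mx.
    by rewrite row_mul row_diag_mx -scalemxAl -rowE.
  apply/eqP => Pk0; have : row k (P *m invmx P) = 0.
    by rewrite row_mul Pk0 mul0mx.
  rewrite mulmxV// => /rowP/(_ k); rewrite !mxE eqxx => /eqP.
  by rewrite oner_eq0.
have AE i j : (A i j * H i j) = \sum_k complex.Re (D 0 k) *
    (complex.Re (P k i) * complex.Re (P k j) * H i j
     + complex.Im (P k i) * complex.Im (P k j) * H i j).
  have -> : A i j * H i j = complex.Re (Ac i j * (H i j)%:C%C).
    by rewrite mxE /= mulr0 subr0.
  rewrite Aspec invmx_unitary ?spectral_unitarymx// mxE mulr_suml raddf_sum/=.
  apply: eq_bigr => k _; rewrite -Re_conj_mul_real -Dreal.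
  congr (complex.Re (_ * _ * _)).
  rewrite mul_mx_diag !mxE; congr (_ * _).
under eq_bigr do under eq_bigr do rewrite AE.
under eq_bigr do rewrite exchange_big.
rewrite exchange_big/=; apply: sumr_ge0 => k _.
under eq_bigr do rewrite -mulr_sumr big_split.
rewrite -mulr_sumr big_split/= mulr_ge0// addr_ge0//; exact: Hpsd.
Qed.

(** * Functions with continuous second partial derivatives *)

Lemma is_derive_line (R : realType) (V : normedModType R) (g : V -> R)
    (x v : V) (t l : R) :
  is_derive (x + t *: v) v g l -> is_derive t 1 (fun s : R => g (x + s *: v)) l.
Proof.
suff E : (fun h : R => h^-1 *: (((fun s : R => g (x + s *: v)) \o shift t) (h *: 1)
             - g (x + t *: v))) =
         (fun h : R => h^-1 *: ((g \o shift (x + t *: v)) (h *: v) - g (x + t *: v))).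
  by case=> [gd gl]; split; [rewrite /derivable E|rewrite /derive E].
apply/funext => h /=; congr (_ *: (g _ - _)).
by rewrite [h *: 1]mulr1 scalerDl addrCA.
Qed.

Lemma mean_value_line (R : realType) (V : normedModType R) (g dg : V -> R)
    (y v : V) (a : R) :
  (forall t : R, 0 <= t <= 1 ->
     is_derive (y + (t * a) *: v) v g (dg (y + (t * a) *: v))) ->
  exists2 t : R, 0 <= t <= 1 &
    g (y + a *: v) - g y = a * dg (y + (t * a) *: v).
Proof.
move=> gd.
pose f (t : R) := g (y + (t * a) *: v).
have fd (t : R) : 0 <= t <= 1 -> is_derive t 1 f (a * dg (y + (t * a) *: v)).
  move=> /gd /is_derive_line gdt.
  have -> : f = (fun s : R => g (y + s *: v)) \o (fun t : R => t * a) by [].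
  rewrite mulrC; apply: is_derive1_comp.
  have -> : (fun t : R => t * a) = (fun t : R => a *: (id : R -> R) t).
    by apply/funext => u; rewrite mulrC.
  by apply: is_derive_eq; rewrite scaler1.
have [] := @MVT R f (fun t => a * dg (y + (t * a) *: v)) 0 1 ltr01.
- by move=> t; rewrite in_itv/= => /andP[t0 t1]; apply: fd; rewrite !ltW.
- apply: derivable_within_continuous => t; rewrite in_itv/= => /fd tf.
  exact: ex_derive.
move=> t; rewrite in_itv/= => /andP[t0 t1].
rewrite /f mul1r mul0r scale0r addr0 subr0 mulr1 => E.
by exists t; rewrite ?ltW.
Qed.

Section gradient.
Context {R : realType} {d : nat}.
Local Notation V := 'rV[R]_d.
Local Notation e i := (delta_mx 0 i : V).

(** Moving from [x] to [x + h v] one coordinate at a time, the mean value theorem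
evaluates each partial derivative at a point that tends to [x] with [h].
Continuity at [x] alone is enough, as the partial derivatives need only exist
nearby. *)
Lemma is_derive_gradient (g : V -> R) (g1 : 'I_d -> V -> R) (x : V) :
  (forall i, \forall y \near x, is_derive y (e i) g (g1 i y)) ->
  (forall i, {for x, continuous (g1 i)}) ->
  forall v : V, is_derive x v g (\sum_i v 0 i * g1 i x).
Proof.
move=> gd g1c v.
suff cvgs (s : seq 'I_d) :
    h^-1 *: (g (h *: (\sum_(i <- s) v 0 i *: e i) + x) - g x) @[h --> 0^']
    --> \sum_(i <- s) v 0 i * g1 i x.
  have := cvgs (index_enum 'I_d); rewrite -row_sum_delta => cv.
  by split; [apply/cvg_ex; exists (\sum_i v 0 i * g1 i x)|apply: cvg_lim].
elim: s => [|i s IHs].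
  rewrite !big_nil; apply: cvg_near_cst; near=> h.
  by rewrite scaler0 add0r subrr scaler0.
rewrite !big_cons; set vs := \sum_(i <- s) _ in IHs *.
have -> : (fun h : R => h^-1 *: (g (h *: (v 0 i *: e i + vs) + x) - g x)) =
    (fun h : R => h^-1 * (g (h *: vs + x + (h * v 0 i) *: e i) - g (h *: vs + x))
              + h^-1 *: (g (h *: vs + x) - g x)).
  apply/funext => h; rewrite -mulrDr; congr (_ * _).
  rewrite addrA subrK; congr (g _ - _).
  by rewrite scalerDr scalerA -addrA [LHS]addrC.
apply: cvgD IHs; apply/cvgrPdist_le => eps eps0.
have v1 : 0 < `|v 0 i| + 1 by rewrite ltr_wpDl.
have /cvgrPdist_le/(_ _ (divr_gt0 eps0 v1)) g1c' := g1c i.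
have [del /= del0 Hdel] := (nbhs_ballP _ _).1 (filterI (gd i) g1c').
pose M := `|vs| + `|v 0 i| * `|e i| + 1.
have M0 : 0 < M by rewrite ltr_wpDl// addr_ge0// mulr_ge0.
near=> h.
have h0 : h != 0 by near: h; exact: nbhs_dnbhs_neq.
have hdel : `|h| * M < del.
  rewrite -ltr_pdivlMr//; near: h; apply: dnbhs0_lt; exact: divr_gt0.
have near_seg (t : R) : 0 <= t <= 1 ->
    ball x del (h *: vs + x + (t * (h * v 0 i)) *: e i).
  move=> /andP[t0 t1]; rewrite -ball_normE /ball_ /= distrC.
  rewrite [_ - x]addrAC addrK.
  apply: le_lt_trans hdel; rewrite (le_trans (ler_normD _ _))//.
  rewrite (normrZ h) (normrZ (t * _)) (normrM t) (normrM h) (ger0_norm t0).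
  rewrite /M -(addrA `|vs|) mulrDr lerD2l -!mulrA.
  apply: (@le_trans _ _ (`|h| * (`|v 0 i| * `|e i|))).
    by rewrite ler_piMl// !mulr_ge0.
  by rewrite ler_wpM2l// lerDl.
have [t t01 ->] := @mean_value_line R V g (g1 i) (h *: vs + x) (e i) (h * v 0 i)
  (fun t t01 => (Hdel _ (near_seg t t01)).1).
have /= := (Hdel _ (near_seg t t01)).2.
rewrite -[h * _ * _]mulrA mulKf// -mulrBr normrM => H.
apply: le_trans (ler_wpM2l (normr_ge0 _) H) _.
rewrite mulrCA; apply: ler_piMr; first exact: ltW.
by rewrite ler_pdivrMr// mul1r lerDl.
Unshelve. all: by end_near. Qed.


(** The first and second partial derivatives are carried along as functions
[g1] and [g2], with [g2 i j] the derivative of [g1 j] in the direction [i], so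
that linear combinations are differentiated term by term without any appeal to
the local nature of the derivative. *)
Record C2_jet (U : set V) (g : V -> R) (g1 : 'I_d -> V -> R)
    (g2 : 'I_d -> 'I_d -> V -> R) : Prop := C2Jet {
  jet_is_derive : forall x i, U x -> is_derive x (e i) g (g1 i x);
  jet_is_derive2 : forall x i j, U x -> is_derive x (e i) (g1 j) (g2 i j x);
  jet_continuous : forall x i, U x -> {for x, continuous (g1 i)};
  jet_continuous2 : forall x i j, U x -> {for x, continuous (g2 i j)}
}.

Lemma C2_jetD U f f1 f2 g g1 g2 :
  C2_jet U f f1 f2 -> C2_jet U g g1 g2 ->
  C2_jet U (fun x => f x + g x) (fun i x => f1 i x + g1 i x)
    (fun i j x => f2 i j x + g2 i j x).
Proof.
move=> [fd fdd fc fcc] [gd gdd gc gcc]; split.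
- by move=> x i Ux; apply: is_deriveD; [exact: fd|exact: gd].
- by move=> x i j Ux; apply: is_deriveD; [exact: fdd|exact: gdd].
- by move=> x i Ux; apply: continuousD; [exact: fc|exact: gc].
- by move=> x i j Ux; apply: continuousD; [exact: fcc|exact: gcc].
Qed.

Lemma C2_jetZ U a f f1 f2 :
  C2_jet U f f1 f2 ->
  C2_jet U (fun x => a * f x) (fun i x => a * f1 i x)
    (fun i j x => a * f2 i j x).
Proof.
move=> [fd fdd fc fcc]; split.
- by move=> x i Ux; apply: is_deriveZ; exact: fd.
- by move=> x i j Ux; apply: is_deriveZ; exact: fdd.
- by move=> x i Ux; apply: continuousM; [exact: cst_continuous|exact: fc].
- by move=> x i j Ux; apply: continuousM; [exact: cst_continuous|exact: fcc].
Qed.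

Lemma is_derive_coord (i j : 'I_d) (x : V) :
  is_derive x (e i) (fun y : V => y 0 j) ((i == j)%:R).
Proof.
have E : h^-1 *: (((fun y : V => y 0 j) \o shift x) (h *: e i) - x 0 j)
    @[h --> 0^'] --> ((i == j)%:R : R).
  apply: cvg_near_cst; near=> h.
  have h0 : h != 0 by near: h; exact: nbhs_dnbhs_neq.
  by rewrite /= !mxE eqxx /= addrK -[_ *: _]/(_ * _) mulKf// eq_sym.
by split; [apply/cvg_ex; exists ((i == j)%:R : R)|apply: cvg_lim].
Unshelve. all: by end_near. Qed.

Lemma C2_jet_one_plus_sqr (U : set V) :
  C2_jet U (fun x => 1 + \sum_i x 0 i ^+ 2) (fun i x => 2 * x 0 i)
    (fun i j _ => 2 * (i == j)%:R).
Proof.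
split.
- move=> x i _.
  have dx (j : 'I_d) : is_derive x (e i) (fun y : V => y 0 j ^+ 2)
      (2 * x 0 j * (i == j)%:R).
    have := is_derive_coord i j x => ?.
    have -> : (fun y : V => y 0 j ^+ 2) = (fun y : V => y 0 j) ^+ 2.
      by apply/funext.
    by apply: is_derive_eq; rewrite -[_ *: _]/(_ * _) expr1 mulr_natl.
  have -> : (fun y : V => 1 + \sum_j y 0 j ^+ 2) =
      cst 1 + \sum_j (fun y : V => y 0 j ^+ 2).
    by apply/funext => y; rewrite /= fct_sumE.
  apply: is_derive_eq; rewrite add0r (bigD1 i)//= eqxx mulr1 big1 ?addr0//.
  by move=> j /negbTE; rewrite eq_sym => ->; rewrite mulr0.
- by move=> x i j _; apply: is_deriveZ; exact: is_derive_coord.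
- move=> x i _; apply: continuousM; first exact: cst_continuous.
  exact: coord_continuous.
- by move=> x i j _; exact: cst_continuous.
Qed.

Lemma C2_jet_is_derive_dir U g g1 g2 x (v : V) : open U ->
  C2_jet U g g1 g2 -> U x -> is_derive x v g (\sum_i v 0 i * g1 i x).
Proof.
move=> oU [gd _ gc _] Ux; apply: is_derive_gradient => [i|i]; last exact: gc.
by near=> y; apply: gd; near: y; exact: open_nbhs_nbhs.
Unshelve. all: by end_near. Qed.

Lemma C2_jet_is_derive_dir2 U g g1 g2 x (v : V) j : open U ->
  C2_jet U g g1 g2 -> U x -> is_derive x v (g1 j) (\sum_i v 0 i * g2 i j x).
Proof.
move=> oU [_ gdd _ gcc] Ux.
apply: (@is_derive_gradient (g1 j) (fun i => g2 i j)) => [i|i]; last exact: gcc.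
by near=> y; apply: gdd; near: y; exact: open_nbhs_nbhs.
Unshelve. all: by end_near. Qed.

End gradient.

(** If [l] were negative then [f1] would be negative just after [0], and by the
mean value theorem [f] would drop below [f 0]. *)
Lemma second_derivative_test (R : realType) (f f1 : R -> R) (l del : R) :
  0 < del -> (forall t : R, `|t| < del -> is_derive t 1 f (f1 t)) ->
  is_derive (0 : R) 1 f1 l -> (forall t, `|t| < del -> f 0 <= f t) ->
  f1 0 = 0 /\ 0 <= l.
Proof.
move=> del0 fd f1d f0.
have inD t : t \in `](- del), del[ -> `|t| < del.
  by rewrite in_itv/= ltr_norml.
have f10 : f1 0 = 0.
  have d0 := fd 0; rewrite normr0 in d0.
  rewrite -(@derive_val _ _ _ _ _ _ _ (d0 del0)).
  apply: derive_val; apply: (@derive1_at_min _ f (- del) del).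
  - by rewrite (@le_trans _ _ 0)// ?oppr_le0 ltW.
  - by move=> t /inD /fd ft; exact: ex_derive.
  - by rewrite in_itv/= oppr_lt0 del0.
  - by move=> t /inD; exact: f0.
split=> //; rewrite leNgt; apply/negP => l0.
have cvl : h^-1 *: (f1 h) @[h --> 0^'] --> l.
  case: f1d => f1d f1l; rewrite -f1l; apply: cvg_trans f1d.
  apply: near_eq_cvg; near=> h.
  by rewrite /= f10 subr0 addr0 [h *: 1]mulr1.
have : \forall h \near 0^', h^-1 *: (f1 h) < 0 by exact: (cvgr_lt l).
move=> /nbhs_ballP[del' /= del'0 H].
pose t := Num.min del del' / 2.
have m0 : 0 < Num.min del del' by rewrite lt_min del0.
have t0 : 0 < t by rewrite divr_gt0.
have tm : t < Num.min del del' by rewrite ltr_pdivrMr// ltr_pMr// ltr1n.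
have [] := @MVT R f f1 0 t t0.
- move=> u; rewrite in_itv/= => /andP[u0 ut]; apply: fd.
  by rewrite gtr0_norm// (lt_trans ut)// (lt_le_trans tm)// ge_min lexx.
- apply: derivable_within_continuous => u; rewrite in_itv/= => /andP[u0 ut].
  have uf : is_derive u 1 f (f1 u).
    by apply: fd; rewrite ger0_norm// (le_lt_trans ut)// (lt_le_trans tm)// ge_min lexx.
  exact: ex_derive.
move=> c; rewrite in_itv/= => /andP[c0 ct].
have : c^-1 *: f1 c < 0.
  apply: H; last by rewrite /= gt_eqF.
  rewrite /ball/= sub0r normrN gtr0_norm//.
  by rewrite (lt_trans ct)// (lt_le_trans tm)// ge_min lexx orbT.
rewrite -[_ *: _]/(_ * _) pmulr_rlt0 ?invr_gt0// => fc E.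
have : f 0 <= f t.
  by apply: f0; rewrite gtr0_norm// (lt_le_trans tm)// ge_min lexx.
by rewrite -subr_ge0 E subr0 pmulr_lge0// leNgt fc.
Unshelve. all: by end_near. Qed.

(** Necessary conditions of first and second order at an interior minimum, from
the second derivative test on the lines through the point.  The form is written
over functions ['I_d -> R] to suit [sym_eigenvalue_ge0_trace_ge0]. *)
Lemma C2_jet_min (R : realType) (d : nat) (U : set 'rV[R]_d) g g1 g2 x :
  open U -> C2_jet U g g1 g2 -> U x -> (forall y, U y -> g x <= g y) ->
  (forall i, g1 i x = 0) /\
  (forall v : 'I_d -> R, 0 <= \sum_i \sum_j v i * v j * g2 i j x).
Proof.
move=> oU gJ Ux gmin.
have key (v : 'rV[R]_d) : \sum_i v 0 i * g1 i x = 0 /\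
    0 <= \sum_i \sum_j v 0 i * v 0 j * g2 i j x.
  have [del /= del0 Hdel] := (nbhs_ballP _ _).1 (open_nbhs_nbhs (conj oU Ux)).
  have v1 : 0 < `|v| + 1 by rewrite ltr_wpDl.
  have inU (t : R) : `|t| < del / (`|v| + 1) -> U (x + t *: v).
    rewrite ltr_pdivlMr// => tdel; apply: Hdel.
    rewrite -ball_normE /ball_ /= opprD addrA subrr sub0r normrN normrZ.
    by apply: le_lt_trans tdel; rewrite ler_wpM2l// lerDl.
  have := @second_derivative_test R (fun t : R => g (x + t *: v))
    (fun t : R => \sum_i v 0 i * g1 i (x + t *: v))
    (\sum_i \sum_j v 0 i * v 0 j * g2 i j x) (del / (`|v| + 1)).
  rewrite scale0r addr0; apply.
  - exact: divr_gt0.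
  - by move=> t /inU Ut; apply: is_derive_line; exact: C2_jet_is_derive_dir gJ _.
  - have -> : (fun t : R => \sum_i v 0 i * g1 i (x + t *: v)) =
        \sum_i (fun t : R => v 0 i * g1 i (x + t *: v)).
      by apply/funext => t; rewrite fct_sumE.
    rewrite exchange_big /=; apply: is_derive_sum => j.
    under eq_bigr do rewrite mulrAC [_ * v 0 j]mulrC. rewrite -mulr_sumr.
    apply: is_deriveZ; apply: is_derive_line; rewrite scale0r addr0.
    exact: C2_jet_is_derive_dir2 gJ _.
  - by move=> t /inU /gmin.
split=> [i|v].
  have [+ _] := key (delta_mx 0 i).
  rewrite (bigD1 i)//= mxE !eqxx mul1r big1 ?addr0// => j ji.
  by rewrite mxE (negbTE ji) andbF mul0r.
have [_ +] := key (\row_i v i).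
by under eq_bigr do under eq_bigr do rewrite !mxE.
Qed.

(** The one-sided condition is what a minimum over a time interval gives at its
right endpoint. *)
Lemma is_derive_left_min (R : realType) (f : R -> R) (s t l : R) :
  s < t -> is_derive t 1 f l -> (forall u, s <= u <= t -> f t <= f u) -> l <= 0.
Proof.
move=> st [fd <-] fmin.
have cv : h^-1 *: (f (h + t) - f t) @[h --> (0:R)^'-] --> 'D_1 f t.
  move=> B /fd[e /= e0 Be]; exists e => // h he h0.
  by have := Be h he (ltr0_neq0 h0); rewrite /= [h *: 1]mulr1.
apply: (cvgr_to_le cv); near=> h.
have h0 : h < 0 by near: h; exact: nbhs_left_lt.
rewrite -[_ *: _]/(_ * _); apply: mulr_le0_ge0; first by rewrite invr_le0 ltW.
rewrite subr_ge0; apply: fmin; rewrite gerDr (ltW h0) andbT -lerBlDr ltW//.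
near: h; apply: nbhs_left_gt; by rewrite subr_lt0.
Unshelve. all: by end_near. Qed.

(** * Euclidean balls *)

Section euclidean.
Context {R : realType} {d : nat}.
Implicit Types (x : 'rV[R]_d) (r : R).

Lemma enorm_ge0 x : 0 <= enorm x.
Proof. exact: sqrtr_ge0. Qed.

Lemma sqr_enorm x : enorm x ^+ 2 = \sum_i x 0 i ^+ 2.
Proof. by rewrite sqr_sqrtr// sumr_ge0// => i _; exact: sqr_ge0. Qed.

Lemma enormZ (a : R) x : enorm (a *: x) = `|a| * enorm x.
Proof.
rewrite /enorm -sqrtr_sqr -sqrtrM ?sqr_ge0// mulr_sumr.
by under eq_bigr do rewrite mxE exprMn.
Qed.

Lemma enorm_coord_le x i : `|x 0 i| <= enorm x.
Proof.
rewrite -sqrtr_sqr ler_wsqrtr// (bigD1 i)//= lerDl.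
by apply: sumr_ge0 => j _; exact: sqr_ge0.
Qed.

Lemma norm_le_enorm x : `|x| <= enorm x.
Proof.
rewrite [leLHS]/Num.norm /= mx_normrE; apply/bigmax_leP; split.
  exact: enorm_ge0.
by move=> [i j] _ /=; rewrite ord1 enorm_coord_le.
Qed.

Lemma continuous_enorm : continuous (@enorm R d).
Proof.
move=> x; apply: (@continuous_comp _ _ _ (fun x : 'rV[R]_d => \sum_i x 0 i ^+ 2)
  Num.sqrt); last exact: sqrt_continuous.
move: x; apply: continuous_big => [|i _]; first exact: add_continuous.
move=> x; apply: (@continuous_comp _ _ _ (fun x : 'rV[R]_d => x 0 i)
  (fun y => y ^+ 2)); [exact: coord_continuous|exact: exprn_continuous].
Qed.

Lemma open_oball r : open (@oball R d r).
Proof.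
apply: (@open_comp _ _ enorm [set y | y < r]); last exact: open_lt.
by move=> x _; exact: continuous_enorm.
Qed.

Lemma closed_cball r : closed (@cball R d r).
Proof.
apply: (@preimage_closed _ _ enorm [set y | y <= r]); last exact: closed_le.
by move=> x _; exact: continuous_enorm.
Qed.

Lemma compact_cball r : compact (@cball R d r).
Proof.
apply: bounded_closed_compact; last exact: closed_cball.
exists r; split; first exact: num_real.
by move=> M rM x xr; rewrite /= (le_trans (norm_le_enorm x))// (le_trans xr)// ltW.
Qed.

Lemma oball_cball r : @oball R d r `<=` cball r.
Proof. by move=> x; exact: ltW. Qed.

Lemma cball_cases r x : cball r x -> oball r x \/ sphere r x.
Proof.
by rewrite /cball/= le_eqVlt => /predU1P[]; [right|left].
Qed.

Lemma enorm_inward r x h : 0 < r -> sphere r x -> 0 < h -> h < r ->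
  enorm (x - h *: (r^-1 *: x)) = r - h.
Proof.
move=> r0 xr h0 hr.
rewrite scalerA -[X in X - _]scale1r -scalerBl enormZ xr.
rewrite ger0_norm; last first.
  by rewrite subr_ge0 ler_pdivrMr// mul1r ltW.
by rewrite mulrBl mul1r mulfVK// gt_eqF.
Qed.

End euclidean.

(** * Minimum principle for cooperative systems *)

Section minimum_principle.
Context {R : realType} {d : nat} {A : finType}.
Local Notation V := 'rV[R]_d.

(** The hypotheses of the minimum principle on the cylinder over [[s, T]].  The
derivatives of [w] are quantified existentially in [css_inequality], so that a
family built from solutions brings its own formulas for them.  By
[css_cooperative] the other components act in the favourable direction at a
minimum that is taken over the index as well. *)
Record cooperative_supersolution (r s T M : R)
    (q : A -> R -> V -> 'M[R]_d) (b : A -> R -> V -> V)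
    (c : A -> A -> R -> V -> R) (w : A -> R -> V -> R) : Prop := {
  css_sym : forall a t x, s < t <= T -> oball r x -> (q a t x)^T = q a t x;
  css_elliptic : forall a t x l, s < t <= T -> oball r x ->
    eigenvalue (q a t x) l -> 0 <= l;
  css_bound_q : forall a t x i j, s < t <= T -> oball r x ->
    `|q a t x i j| <= M;
  css_bound_b : forall a t x j, s < t <= T -> oball r x -> `|b a t x 0 j| <= M;
  css_bound_c : forall a a' t x, s < t <= T -> oball r x -> `|c a a' t x| <= M;
  css_cooperative : forall a a' t x, a != a' -> 0 <= c a a' t x;
  css_continuous : forall a,
    {within `[s, T]%classic `*` cball r, continuous (fun p => w a p.1 p.2)};
  css_inequality : forall a t, s < t <= T ->
    exists g1 g2, C2_jet (oball r) (w a t) g1 g2 /\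
      forall x, oball r x -> exists2 dw, is_derive t 1 (w a ^~ x) dw &
        \sum_i \sum_j q a t x i j * g2 i j x + \sum_j b a t x 0 j * g1 j x
        + \sum_a' c a a' t x * w a' t x <= dw;
  css_neumann : forall a t x, s < t <= T -> sphere r x ->
    h^-1 * (w a t x - w a t (x - h *: (r^-1 *: x))) @[h --> 0^'+] --> (0 : R);
  css_initial : forall a x, oball r x -> 0 <= w a s x
}.
Arguments css_sym {r s T M q b c w} _ a [t x].
Arguments css_elliptic {r s T M q b c w} _ a [t x] l.
Arguments css_continuous {r s T M q b c w} _ a.
Arguments css_neumann {r s T M q b c w} _ a [t x].
Arguments css_inequality {r s T M q b c w} _ a [t].

(** The factor [expR (- lam * (t - s))] makes the coefficient of order zero as
negative as needed; the added term has positive normal derivative on spheres. *)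
Definition barrier (lam eps s : R) (w : R -> V -> R) (t : R) (x : V) : R :=
  expR (- lam * (t - s)) * w t x + eps * (1 + \sum_i x 0 i ^+ 2).

(** The first two sums bound the second and first order terms of the operator
applied to [1 + |x|^2], whose gradient is [2 x] and Hessian [2] times the
identity; the third bounds the sum of a row of the coupling. *)
Definition barrier_rate (r M : R) : R :=
  \sum_(i < d) \sum_(j < d) (M * 2) + \sum_(j < d) (M * (2 * r))
  + \sum_(a : A) M + 1.

Context (r s T M : R) (q : A -> R -> V -> 'M[R]_d) (b : A -> R -> V -> V).
Context (c : A -> A -> R -> V -> R) (w : A -> R -> V -> R).
Context (r0 : 0 < r) (wS : cooperative_supersolution r s T M q b c w).

(** The initial inequality passes to the sphere by continuity along the inward
normal. *)
Lemma css_initial_cball a x : s <= T -> cball r x -> 0 <= w a s x.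
Proof.
move=> sT /cball_cases[/(css_initial wS)//|xr].
rewrite leNgt; apply/negP => w0.
have wc : {within `[s, T]%classic `*` cball r, continuous (fun p => w a p.1 p.2)}.
  exact: css_continuous wS a.
move: wc => /subspace_continuousP/(_ (s, x)).
have Dx : (`[s, T]%classic `*` cball r) (s, x).
  by split; rewrite /= ?in_itv/= ?lexx//= /cball/= xr.
move=> /(_ Dx) cv.
have : \forall p \near within (`[s, T]%classic `*` cball r) (nbhs (s, x)),
    w a p.1 p.2 < 0 by exact: (cvgr_lt (w a s x)).
rewrite near_withinE => -[[B1 B2] /= [nB1 nB2] HB].
have pc : x - h *: (r^-1 *: x) @[h --> (0 : R)] --> x.
  have : x - h *: (r^-1 *: x) @[h --> (0 : R)] --> x - 0 *: (r^-1 *: x).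
    by apply: cvgB; [exact: cvg_cst|apply: cvgZr_tmp; exact: cvg_id].
  by rewrite scale0r subr0.
have [del /= del0 Hdel] := (nbhs_ballP _ _).1 (pc _ nB2).
pose h := Num.min del r / 2.
have m0 : 0 < Num.min del r by rewrite lt_min del0.
have h0 : 0 < h by rewrite divr_gt0.
have hm : h < Num.min del r by rewrite ltr_pdivrMr// ltr_pMr// ltr1n.
have [hdel hr] : h < del /\ h < r.
  by split; apply: (lt_le_trans hm); rewrite ge_min lexx ?orbT.
have xh : oball r (x - h *: (r^-1 *: x)).
  by rewrite /oball/= enorm_inward// gtrBl.
have : w a s (x - h *: (r^-1 *: x)) < 0.
  apply: (HB (s, x - h *: (r^-1 *: x))); split=> /=.
  - exact: nbhs_singleton nB1.
  - by apply: Hdel; rewrite /ball/= sub0r normrN gtr0_norm.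
  - by rewrite in_itv/= lexx.
  - exact: oball_cball.
by rewrite ltNge (css_initial wS).
Qed.

(** At a minimum on the sphere the difference quotients in the normal direction
are nonpositive, whereas they tend to [2 r eps]. *)
Lemma barrier_no_boundary_min lam eps a t x : 0 < eps -> s < t <= T ->
  sphere r x ->
  ~ (forall y, cball r y ->
       barrier lam eps s (w a) t x <= barrier lam eps s (w a) t y).
Proof.
move=> eps0 stT xr xmin.
pose E := expR (- lam * (t - s)).
have cv : E * (h^-1 * (w a t x - w a t (x - h *: (r^-1 *: x))))
    + eps * (2 * r - h) @[h --> 0^'+] --> E * 0 + eps * (2 * r - 0).
  apply: cvgD.
    apply: cvgM; first exact: cvg_cst.
    by have := css_neumann wS a stT xr.
  apply: cvgM; first exact: cvg_cst.
  apply: cvgB; first exact: cvg_cst.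
  exact: cvg_at_right_filter.
have : E * 0 + eps * (2 * r - 0) <= 0.
  apply: (cvgr_to_le cv); near=> h.
  have h0 : 0 < h by near: h; exact: nbhs_right_gt.
  have hr : h < r by near: h; exact: nbhs_right_lt.
  have xh : cball r (x - h *: (r^-1 *: x)).
    by rewrite /cball/= enorm_inward// gerBl ltW.
  have := xmin _ xh; rewrite /barrier -!sqr_enorm enorm_inward// xr -/E.
  rewrite -subr_le0 => H.
  rewrite -(pmulr_rle0 _ h0); apply: le_trans H.
  rewrite le_eqVlt; apply/orP; left; apply/eqP.
  have hn : h != 0 by rewrite gt_eqF.
  by field.
rewrite mulr0 add0r subr0 leNgt => /negP; apply.
by rewrite !mulr_gt0.
Unshelve. all: by end_near. Qed.

(** Write [W] for the damped value of [w a] at the minimum, [psi] for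
[1 + |x|^2] and [Cs] for the row sum of the coupling.  The conditions at a
minimum turn the differential inequality into
[(lam - Cs) (- W) <= eps (P + B)], where [P] and [B] are the second and first
order terms of the operator applied to [psi].  Negativity of the minimum gives
[- W >= eps], and the choice of [lam] makes [lam - Cs] exceed [P + B] by at least [1]. *)
Lemma barrier_no_interior_min eps a t x (y := barrier (barrier_rate r M) eps s) :
  0 < eps -> s < t <= T -> oball r x -> y (w a) t x < 0 ->
  (forall a', y (w a) t x <= y (w a') t x) ->
  (forall z, oball r z -> y (w a) t x <= y (w a) t z) ->
  (forall u, s <= u <= t -> y (w a) t x <= y (w a) u x) -> False.
Proof.
move=> eps0 stT xr yneg ymina yminx ymint.
pose lam := barrier_rate r M; pose psi : R := 1 + \sum_i x 0 i ^+ 2.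
pose E := expR (- lam * (t - s)).
have psi1 : 1 <= psi.
  by rewrite lerDl sumr_ge0// => i _; exact: sqr_ge0.
have [g1 [g2 [wJ]]] := css_inequality wS a stT.
move=> /(_ _ xr)[dw wd wineq].
have yJ := C2_jetD (C2_jetZ E wJ) (C2_jetZ eps (C2_jet_one_plus_sqr (oball r))).
have [grad0 hess] := C2_jet_min (@open_oball R d r) yJ xr yminx.
pose P := \sum_i \sum_j q a t x i j * (2 * (i == j)%:R).
pose B := \sum_j b a t x 0 j * (2 * x 0 j).
pose S1 := \sum_i \sum_j q a t x i j * g2 i j x.
pose S2 := \sum_j b a t x 0 j * g1 j x.
pose S3 := \sum_a' c a a' t x * w a' t x.
pose Cs := \sum_a' c a a' t x.
have trace : 0 <= E * S1 + eps * P.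
  pose H : 'M[R]_d := \matrix_(i, j) (E * g2 i j x + eps * (2 * (i == j)%:R)).
  have -> : E * S1 + eps * P = \sum_i \sum_j q a t x i j * H i j.
    rewrite !mulr_sumr -big_split/=; apply: eq_bigr => i _.
    rewrite !mulr_sumr -big_split/=; apply: eq_bigr => j _.
    by rewrite mxE mulrDr mulrCA (mulrCA _ eps).
  apply: sym_eigenvalue_ge0_trace_ge0 (css_sym wS a stT xr) _ _.
    by move=> l; have := css_elliptic wS a l stT xr.
  move=> v; have := hess v.
  by under [X in _ -> 0 <= X]eq_bigr do under eq_bigr do rewrite mxE.
have grad : E * S2 + eps * B = 0.
  rewrite !mulr_sumr -big_split/= big1// => j _.
  by rewrite mulrCA (mulrCA eps) -mulrDr grad0 mulr0.
(* The minimum over the index bounds the other components from below; the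
   component [a] itself needs no sign of its coefficient. *)
have zeroth : Cs * y (w a) t x <= E * S3 + eps * psi * Cs.
  rewrite /Cs mulr_suml !mulr_sumr -big_split/=; apply: ler_sum => a' _.
  rewrite mulrCA [eps * psi * _]mulrC -mulrDr.
  have [<-//|aa'] := eqVneq a a'.
  by rewrite ler_wpM2l ?(css_cooperative wS)// ymina.
have time : E * dw - lam * (E * w a t x) <= 0.
  apply: (is_derive_left_min (s := s) (t := t) (f := fun u => y (w a) u x)) => //.
    by case/andP: stT.
  rewrite /y /barrier -/lam.
  have Ed : is_derive t 1 (fun u : R => expR (- lam * (u - s))) (- lam * E).
    have -> : (fun u : R => expR (- lam * (u - s))) =
              expR \o (fun u : R => - lam * (u - s)) by [].
    rewrite mulrC; apply: is_derive1_comp.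
    have -> : (fun u : R => - lam * (u - s)) = - lam *: ((id : R -> R) - cst s).
      by apply/funext.
    by apply: is_derive_eq; rewrite subr0 [_ *: _]mulr1.
  have -> : (fun u => expR (- lam * (u - s)) * w a u x + eps * psi) =
     (fun u => expR (- lam * (u - s))) * (w a ^~ x) + cst (eps * psi).
    by apply/funext.
  apply: is_derive_eq; rewrite addr0 -/E -![_ *: _]/(_ * _); ring.
have Pb : `|P| <= \sum_(i < d) \sum_(j < d) (M * 2).
  apply: (le_trans (ler_norm_sum _ _ _)); apply: ler_sum => i _.
  apply: (le_trans (ler_norm_sum _ _ _)); apply: ler_sum => j _.
  rewrite normrM ler_pM// ?(css_bound_q wS)//.
  by case: eqP => _; rewrite ?mulr1 ?mulr0 ?normr0// ger0_norm.
have Bb : `|B| <= \sum_(j < d) (M * (2 * r)).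
  apply: (le_trans (ler_norm_sum _ _ _)); apply: ler_sum => j _.
  rewrite normrM ler_pM// ?(css_bound_b wS)// normrM ger0_norm// ler_pM2l//.
  exact: le_trans (enorm_coord_le x j) (ltW xr).
have Cb : `|Cs| <= \sum_(a' : A) M.
  apply: (le_trans (ler_norm_sum _ _ _)); apply: ler_sum => a' _.
  exact: (css_bound_c wS).
have E0 : 0 < E by exact: expR_gt0.
have wineqE : E * (S1 + S2 + S3) <= E * dw by rewrite ler_pM2l.
have yE : y (w a) t x = E * w a t x + eps * psi by [].
have lamE : lam = \sum_(i < d) \sum_(j < d) (M * 2)
  + \sum_(j < d) (M * (2 * r)) + \sum_(a : A) M + 1 by [].
have K10 := le_trans (normr_ge0 P) Pb; have K20 := le_trans (normr_ge0 B) Bb.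
move: Pb Bb Cb lamE K10 K20; set K1 := \sum_(_ < _) _; set K2 := \sum_(_ < _) _.
set K3 := \sum_(_ : A) _.
rewrite !ler_norml => /andP[_ Pb] /andP[_ Bb] /andP[_ Cb] lamE K10 K20.
move: yneg zeroth time; rewrite yE; set W := E * w a t x => yneg zeroth time.
have h1 : (lam - Cs) * (- W) <= eps * (P + B) by lra.
have h2 : eps * (P + B) <= eps * (K1 + K2) by rewrite ler_pM2l// lerD.
have h3 : eps <= - W.
  by apply: (@le_trans _ _ (eps * psi)); [rewrite ler_peMr// ltW|lra].
have h4 : (K1 + K2 + 1) * eps <= (lam - Cs) * (- W).
  by apply: ler_pM => //; lra.
by lra.
Qed.

Lemma continuous_barrier lam eps a :
  {within `[s, T]%classic `*` cball r,
    continuous (fun p => barrier lam eps s (w a) p.1 p.2)}.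
Proof.
have ec : continuous (fun p : R * V => expR (- lam * (p.1 - s))).
  move=> p; apply: (@continuous_comp _ _ _ (fun p : R * V => - lam * (p.1 - s))
    expR); last exact: continuous_expR.
  apply: continuousM; first exact: cst_continuous.
  by apply: continuousB; [exact: cvg_fst|exact: cst_continuous].
have pc : continuous (fun p : R * V => eps * (1 + \sum_i p.2 0 i ^+ 2)).
  move=> p; apply: cvgM; first exact: cvg_cst.
  apply: cvgD; first exact: cvg_cst.
  apply: (@continuous_comp _ _ _ snd (fun x : V => \sum_i x 0 i ^+ 2)).
    exact: cvg_snd.
  have -> : (fun x : V => \sum_i x 0 i ^+ 2) = (fun x => enorm x ^+ 2).
    by apply/funext => x; rewrite sqr_enorm.
  apply: (@continuous_comp _ _ _ enorm (fun y : R => y ^+ 2)).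
    exact: continuous_enorm.
  exact: exprn_continuous.
rewrite /barrier => p; apply: cvgD; last exact: (continuous_subspaceT pc).
apply: cvgM; first exact: (continuous_subspaceT ec).
exact: css_continuous wS a p.
Qed.

Lemma barrier_ge0 eps a t x : 0 < eps -> s <= t <= T -> cball r x ->
  0 <= barrier (barrier_rate r M) eps s (w a) t x.
Proof.
move=> eps0 stT xr; rewrite leNgt; apply/negP => yneg.
pose y a (p : R * V) := barrier (barrier_rate r M) eps s (w a) p.1 p.2.
pose K := `[s, T]%classic `*` @cball R d r.
have Ktx : K (t, x) by split; rewrite //= in_itv.
have Kc : compact K.
  by apply: compact_setX; [exact: segment_compact|exact: compact_cball].
have ymin a' : {p | K p & forall z, K z -> y a' p <= y a' z}.
  apply: cid2; have [p] := compact_EVT_min (ex_intro _ _ Ktx) Kc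
    (@continuous_barrier (barrier_rate r M) eps a').
  by rewrite inE => Kp pmin; exists p => // z Kz; apply: pmin; rewrite inE.
pose p a' := s2val (ymin a').
have [a1 _ a1min] := @Order.TotalTheory.arg_minP _ _ _ a xpredT
  (fun a' => y a' (p a')) isT.
have y1min a' z : K z -> y a1 (p a1) <= y a' z.
  move=> Kz; apply: le_trans (a1min a' isT) _; exact: (s2valP' (ymin a')).
have y1neg : y a1 (p a1) < 0 by exact: le_lt_trans (y1min a _ Ktx) yneg.
have : K (p a1) by exact: (s2valP (ymin a1)).
(* [p a1] is now a minimum over the index, the time and the closed ball. *)
case: (p a1) y1min y1neg => t1 x1 y1min y1neg [/=].
rewrite in_itv/= => /andP[st1 t1T] x1r.
have x1psi : 0 < 1 + \sum_i x1 0 i ^+ 2.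
  by rewrite ltr_wpDr// sumr_ge0// => i _; exact: sqr_ge0.
move: st1; rewrite le_eqVlt => /predU1P[st1|st1].
  move: y1neg; rewrite ltNge /y /barrier/= -st1 => /negP; apply.
  rewrite addr_ge0 ?mulr_ge0 ?expR_ge0 ?(ltW eps0) ?(ltW x1psi)//.
  by apply: css_initial_cball => //; rewrite st1.
have st1T : s < t1 <= T by rewrite st1.
case: (cball_cases x1r) => [x1o|x1s].
  apply: (barrier_no_interior_min eps0 st1T x1o y1neg).
  - by move=> a'; apply: (y1min a' (t1, x1)); split; rewrite //= in_itv/= (ltW st1).
  - move=> z /oball_cball zr; apply: (y1min a1 (t1, z)).
    by split; rewrite //= in_itv/= (ltW st1).
  - move=> u /andP[su ut]; apply: (y1min a1 (u, x1)).
    by split; rewrite //= in_itv/= su (le_trans ut).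
apply: (barrier_no_boundary_min eps0 st1T x1s
  (lam := barrier_rate r M) (a := a1)) => z zr.
apply: (y1min a1 (t1, z)).
by split; rewrite //= in_itv/= (ltW st1).
Qed.

Lemma cooperative_supersolution_ge0 a t x : s <= t <= T -> cball r x -> 0 <= w a t x.
Proof.
move=> stT xr; rewrite leNgt; apply/negP => w0.
pose E := expR (- barrier_rate r M * (t - s)).
pose psi : R := 1 + \sum_i x 0 i ^+ 2.
have psi0 : 0 < psi.
  by rewrite ltr_wpDr// sumr_ge0// => i _; exact: sqr_ge0.
have Ew : E * w a t x < 0 by rewrite pmulr_rlt0// expR_gt0.
(* With this value the added term is half the damped one in absolute value. *)
have eps0 : 0 < - (E * w a t x) / (2 * psi).
  by rewrite divr_gt0 ?oppr_gt0// mulr_gt0.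
have := barrier_ge0 a eps0 stT xr; rewrite /barrier -/E -/psi.
have -> : - (E * w a t x) / (2 * psi) * psi = - (E * w a t x) / 2.
  by field; rewrite gt_eqF.
by move: (E * _) Ew => W; lra.
Qed.

End minimum_principle.

(** * Coefficients and classical solutions *)

Section coefficients.
Context {R : realType} {d : nat}.
Local Notation V := 'rV[R]_d.

(** On the cylinder the distance to the point [(s, 0)] is bounded, hence so is
the Hoelder increment. *)
Lemma parabolic_Hoelder_bounded (alpha : R) (I : set R) (g : R -> V -> R)
    (s T r : R) : 0 < alpha -> 0 < r -> `[s, T]%classic `<=` I ->
  locally_parabolic_Hoelder alpha I g ->
  exists M, forall t x, s <= t <= T -> cball r x -> `|g t x| <= M.
Proof.
move=> a0 r0 sTI gH; pose K := `[s, T]%classic `*` @cball R d r.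
have Kc : compact K.
  by apply: compact_setX; [exact: segment_compact|exact: compact_cball].
have KI : K `<=` I `*` setT by move=> p [] /sTI.
have [L HL] := gH K Kc KI.
exists (`|g s 0| + `|L| * ((T - s) `^ (alpha / 2) + (2 * r) `^ alpha)).
move=> t x stT xr; have /andP[st tT] := stT.
have Ktx : K (t, x) by split; rewrite //= in_itv.
have Ks0 : K (s, 0).
  split; first by rewrite /= in_itv/= lexx (le_trans st).
  by rewrite /cball/= -(scale0r (0 : V)) enormZ normr0 mul0r ltW.
rewrite -[g t x](subrK (g s 0)) addrC (le_trans (ler_normD _ _))// lerD2l.
apply: (le_trans (HL _ _ Ktx Ks0)) => /=.
apply: (@le_trans _ _ (`|L| * (`|t - s| `^ (alpha / 2) + enorm (x - 0) `^ alpha))).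
  by rewrite ler_wpM2r ?ler_norm// addr_ge0 ?powR_ge0.
rewrite ler_wpM2l// lerD//.
  rewrite ge0_ler_powR ?nnegrE ?divr_ge0 ?subr_ge0 ?(ltW a0)//.
    exact: le_trans tT.
  by rewrite ger0_norm ?subr_ge0// lerD2r.
rewrite subr0 ge0_ler_powR ?nnegrE ?enorm_ge0 ?(ltW a0) ?mulr_ge0 ?(ltW r0)//.
by rewrite (le_trans xr)// ler_peMl ?(ltW r0)// ler1n.
Qed.

Lemma finite_common_bound (A : finType) (P : Type) (K : set P) (g : A -> P -> R) :
  (forall a, exists M, forall p, K p -> `|g a p| <= M) ->
  exists2 M, 0 <= M & forall a p, K p -> `|g a p| <= M.
Proof.
move=> /choice[M HM]; exists (\sum_a `|M a|); first exact: sumr_ge0.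
move=> a p Kp; rewrite (le_trans (HM a p Kp))// (bigD1 a)//=.
by rewrite (le_trans (ler_norm _))// lerDl sumr_ge0.
Qed.

(** Ellipticity is applied on the interval reduced to [t].  The infimum of
the eigenvalues being positive, the convention by which the infimum is [0]
when it does not exist is ruled out. *)
Lemma ellipticity_eigenvalue_gt0 (m : nat) (I : set R)
    (Q : 'I_m -> R -> V -> 'M[R]_d) k t x a :
  ellipticity I Q -> I t -> eigenvalue (Q k t x) a -> 0 < a.
Proof.
move=> ell It Qa.
have tJ : bounded_subinterval I [set t].
  split; [|exact/compact_bounded/compact_set1|by move=> _ ->].
  by move=> _ _ -> -> z /andP[tz zt]; apply/eqP; rewrite eq_le zt.
have mu0 : 0 < min_eigenvalue (Q k t x).
  rewrite -lte_fin; apply: (lt_le_trans (ell _ tJ k)).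
  by apply: ereal_inf_lbound; exists (t, x).
apply: (lt_le_trans mu0); apply: ge_inf => //.
have [[_ //]|noinf] := pselect (has_inf [set a | eigenvalue (Q k t x) a]).
by move: mu0; rewrite /min_eigenvalue inf_out// ltxx.
Qed.

Lemma right_halfline_segment (I : set R) s t : right_halfline I -> I s ->
  `[s, t]%classic `<=` I.
Proof.
move=> [->//|[a [->|->]]] /=; rewrite in_itv/= andbT => sa z;
  rewrite /= !in_itv/= andbT => /andP[sz _].
- exact: lt_le_trans sz.
- exact: le_trans sz.
Qed.

Lemma of_class_C12_jet (s r t : R) (w : R -> V -> R) :
  of_class_C12 (`]s, +oo[%classic `*` oball r) w -> s < t ->
  C2_jet (oball r) (w t) (fun i => partial i (w t))
    (fun i j => partial2 i j (w t)).
Proof.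
move=> [_ wd _ w1 w2] st.
have oD : open (`]s, +oo[%classic `*` @oball R d r).
  have -> : `]s, +oo[%classic `*` @oball R d r =
      fst @^-1` `]s, +oo[%classic `&` snd @^-1` oball r by [].
  apply: openI; apply: open_comp.
  - by move=> p _; exact: cvg_fst.
  - exact: interval_open.
  - by move=> p _; exact: cvg_snd.
  - exact: open_oball.
have Dx x : oball r x -> (`]s, +oo[%classic `*` @oball R d r) (t, x).
  by move=> xr; split; rewrite //= in_itv/= st.
have slice (g : R -> V -> R) x : oball r x ->
    {within `]s, +oo[%classic `*` oball r, continuous (fun p => g p.1 p.2)} ->
    {for x, continuous (g t)}.
  rewrite continuous_open_subspace// => xr /(_ (t, x) (mem_set (Dx x xr))) gc.
  apply: (@continuous_comp _ _ _ (fun y : V => (t, y)) (fun p => g p.1 p.2)) => //.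
  move=> B [[B1 B2] /= [nB1 nB2] HB]; apply: filterS nB2 => y B2y.
  by apply: (HB (t, y)); split=> //; exact: nbhs_singleton nB1.
split.
- move=> x i xr; have [_ [+ _]] := wd _ (Dx _ xr).
  by move=> /(_ i) wi; split.
- move=> x i j xr; have [_ [_ +]] := wd _ (Dx _ xr).
  by move=> /(_ i j) wi; split.
- by move=> x i xr; apply: (slice (fun t => partial i (w t))).
- by move=> x i j xr; apply: (slice (fun t => partial2 i j (w t))).
Qed.

Lemma continuous_abs_vec m : continuous (@abs_vec R m).
Proof.
move=> x B /nbhs_ballP[e /= e0 eB]; apply/nbhs_ballP; exists e => // y.
rewrite -ball_normE /= => xy; apply: eB; rewrite -ball_normE /=.
apply: le_lt_trans xy.
rewrite [leLHS]/Num.norm /= [leRHS]/Num.norm /= !mx_normrE.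
apply: le_bigmax2 => -[i j] _ /=.
by rewrite !mxE ler_dist_dist.
Qed.

End coefficients.

(** * Sign splitting *)

Section sign_splitting.
Context {R : realType} {d m : nat}.
Local Notation V := 'rV[R]_d.

(** The index [(sg, k)] stands for [v_k + u_k] if [sg] is [false] and for
[v_k - u_k] if it is [true]. *)
Definition signed_sum (u v : R -> V -> 'rV[R]_m) (a : bool * 'I_m)
  (t : R) (x : V) : R := v t x 0 a.2 + (-1) ^+ a.1 * u t x 0 a.2.

Definition flips_sign (C : R -> V -> 'M[R]_m) (k h : 'I_m) (t : R) (x : V) : bool :=
  (h != k) && (C t x k h < 0).

(** Row [(sg, k)] puts the whole of [c^P_kh] on one of the two unknowns with index
[h]: the one with sign [sg], or the opposite one when [c_kh] is a negative
off-diagonal entry. *)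
Definition doubled_coupling (C : R -> V -> 'M[R]_m) (a a' : bool * 'I_m)
    (t : R) (x : V) : R :=
  if a'.1 == a.1 (+) flips_sign C a.2 a'.2 t x
  then offdiag_abs C t x a.2 a'.2 else 0.

(** The diagonal entries [c_kk], which have no sign, stay on the diagonal, as
[flips_sign] vanishes there. *)
Lemma doubled_coupling_ge0 C a a' t x : a != a' ->
  0 <= doubled_coupling C a a' t x.
Proof.
case: a a' => [sg k] [sg' h]; rewrite /doubled_coupling /flips_sign /= mxE.
have [->|_] := eqVneq h k; last by case: ifP.
by rewrite addbF; case: (eqVneq sg' sg) => [->|//]; rewrite eqxx.
Qed.

Lemma norm_doubled_coupling_le C a a' t x :
  `|doubled_coupling C a a' t x| <= `|C t x a.2 a'.2|.
Proof.
rewrite /doubled_coupling mxE; case: ifP => _; last by rewrite normr0.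
by case: ifP => _; rewrite ?normr_id.
Qed.

Lemma offdiag_abs_flips_sign C k h t x :
  offdiag_abs C t x k h * (-1) ^+ flips_sign C k h t x = C t x k h.
Proof.
rewrite mxE /flips_sign; case: eqVneq => _ /=; first by rewrite mulr1.
by case: ltrP => c0; rewrite ?expr1 ?expr0 ?mulr1 ?mulrN1;
  [rewrite ltr0_norm// opprK|rewrite ger0_norm].
Qed.

(** The doubled coupling reproduces [C^P v +- C u], because changing the sign of
[u_h] exactly when [c_kh < 0] turns [|c_kh|] into [c_kh]. *)
Lemma sum_doubled_coupling C u v sg k t x :
  \sum_a' doubled_coupling C (sg, k) a' t x * signed_sum u v a' t x =
  \sum_h offdiag_abs C t x k h * v t x 0 h
  + (-1) ^+ sg * \sum_h C t x k h * u t x 0 h.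
Proof.
pose F sg' h := doubled_coupling C (sg, k) (sg', h) t x *
  signed_sum u v (sg', h) t x.
rewrite (eq_bigr (fun a => F a.1 a.2)); last by case.
rewrite -(pair_bigA _ F)/= exchange_big/= mulr_sumr -big_split/=.
apply: eq_bigr => h _; rewrite (bigD1 (sg (+) flips_sign C k h t x))//= big1.
  rewrite addr0 /F /doubled_coupling eqxx /signed_sum/=.
  rewrite -[in X in _ = _ + X](offdiag_abs_flips_sign C k h).
  by rewrite signr_addb; ring.
by move=> sg' /negbTE sgE; rewrite /F /doubled_coupling /= sgE mul0r.
Qed.

End sign_splitting.

(** Since [g] dominates [|f|], the sums [v +- u] start from nonnegative data, and
they solve the doubled system with equality. *)
Lemma signed_sum_cooperative_supersolution (R : realType) (d m : nat) (I : set R)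
    (Q : 'I_m -> R -> 'rV[R]_d -> 'M[R]_d)
    (b : 'I_m -> R -> 'rV[R]_d -> 'rV[R]_d)
    (C : R -> 'rV[R]_d -> 'M[R]_m) (r s T : R)
    (f g : 'rV[R]_d -> 'rV[R]_m) (u v : R -> 'rV[R]_d -> 'rV[R]_m) :
  coef_Hoelder I Q b C -> ellipticity I Q -> `[s, T]%classic `<=` I -> 0 < r ->
  neumann_solution Q b C r s f u ->
  neumann_solution Q b (offdiag_abs C) r s g v ->
  (forall x k, oball r x -> `|f x 0 k| <= g x 0 k) ->
  exists M, cooperative_supersolution r s T M
    (fun a : bool * 'I_m => Q a.2) (fun a => b a.2)
    (doubled_coupling C) (signed_sum u v).
Proof.
move=> [Qsym [alpha [/andP[alpha0 _] [QH bH CH]]]] Qell sTI r0.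
move=> [[uc uC12] uE uN u0] [[vc vC12] vE vN v0] fg.
pose K (p : R * 'rV[R]_d) := s <= p.1 <= T /\ cball r p.2.
have bounded (h : R -> 'rV[R]_d -> R) : locally_parabolic_Hoelder alpha I h ->
    exists M, forall p, K p -> `|h p.1 p.2| <= M.
  move=> /(parabolic_Hoelder_bounded alpha0 r0 sTI)[M HM].
  by exists M => -[t x] [stT xr]; exact: HM.
have [MQ MQ0 HMQ] := @finite_common_bound R ('I_m * ('I_d * 'I_d))%type _ K
  (fun a p => Q a.1 p.1 p.2 a.2.1 a.2.2) (fun a => bounded _ (QH _ _ _)).
have [Mb Mb0 HMb] := @finite_common_bound R ('I_m * 'I_d)%type _ K
  (fun a p => b a.1 p.1 p.2 0 a.2) (fun a => bounded _ (bH _ _)).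
have [MC MC0 HMC] := @finite_common_bound R ('I_m * 'I_m)%type _ K
  (fun a p => C p.1 p.2 a.1 a.2) (fun a => bounded _ (CH _ _)).
have inI t : s < t <= T -> I t.
  by move=> /andP[st tT]; apply: sTI; rewrite /= in_itv/= ltW.
have inK t x : s < t <= T -> oball r x -> K (t, x).
  by move=> /andP[st tT] /oball_cball xr; split => //=; rewrite ltW.
exists (MQ + Mb + MC); split.
- by move=> a t x stT xr; apply/matrixP => i j; rewrite mxE Qsym//; exact: inI.
- move=> a t x l stT xr Ql; apply: ltW.
  exact: ellipticity_eigenvalue_gt0 Qell (inI _ stT) Ql.
- move=> a t x i j stT xr.
  apply: (le_trans (HMQ (a.2, (i, j)) _ (inK _ _ stT xr))).
  by rewrite -addrA lerDl addr_ge0.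
- move=> a t x j stT xr; apply: (le_trans (HMb (a.2, j) _ (inK _ _ stT xr))).
  by rewrite addrAC lerDr addr_ge0.
- move=> a a' t x stT xr; apply: (le_trans (norm_doubled_coupling_le _ _ _ _ _)).
  apply: (le_trans (HMC (a.2, a'.2) _ (inK _ _ stT xr))).
  by rewrite lerDr addr_ge0.
- by move=> *; exact: doubled_coupling_ge0.
- move=> [sg k]; rewrite /signed_sum/=.
  have sub : `[s, T]%classic `*` cball r `<=` `[s, +oo[%classic `*` @cball R d r.
    by move=> p [/= + pr]; rewrite !in_itv/= andbT => /andP[].
  have kc (z : R -> 'rV[R]_d -> 'rV[R]_m) :
      {within `[s, +oo[%classic `*` cball r, continuous (fun p => z p.1 p.2)} ->
      {within `[s, T]%classic `*` cball r, continuous (fun p => z p.1 p.2 0 k)}.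
    move=> /(continuous_subspaceW sub) zc p.
    by have := cvg_comp _ _ (zc p) (@coord_continuous R 1 m 0 k _).
  move=> p; apply: cvgD; first exact: (kc _ vc).
  by apply: cvgM; [exact: cvg_cst|exact: (kc _ uc)].
- move=> [sg k] t stT; have /andP[st tT] := stT.
  have uJ := of_class_C12_jet (uC12 k) st.
  have vJ := of_class_C12_jet (vC12 k) st.
  have wJ := C2_jetD vJ (C2_jetZ ((-1) ^+ sg) uJ).
  eexists; eexists; split; first exact: wJ.
  move=> x xr; have stD : (`]s, +oo[%classic `*` oball r) (t, x).
    by split; rewrite //= in_itv/= st.
  have [_ /(_ _ stD)[ud _] _ _ _] := uC12 k.
  have [_ /(_ _ stD)[vd _] _ _ _] := vC12 k.
  have {}ud : is_derive t 1 (fun tau => u tau x 0 k) (system_op Q b C t (u t) x 0 k).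
    by rewrite -uE// derive1E; exact: derivableP.
  have {}vd : is_derive t 1 (fun tau => v tau x 0 k)
      (system_op Q b (offdiag_abs C) t (v t) x 0 k).
    by rewrite -vE// derive1E; exact: derivableP.
  exists (system_op Q b (offdiag_abs C) t (v t) x 0 k
      + (-1) ^+ sg * system_op Q b C t (u t) x 0 k).
    exact: is_deriveD vd (is_deriveZ _ ud).
  rewrite sum_doubled_coupling !mxE /= le_eqVlt; apply/orP; left; apply/eqP.
  under eq_bigr do under eq_bigr do rewrite mulrDr mulrCA.
  under eq_bigr do rewrite big_split -mulr_sumr.
  rewrite big_split -mulr_sumr/=.
  under [X in _ + X + _ = _]eq_bigr do rewrite mulrDr mulrCA.
  rewrite big_split -mulr_sumr/=.
  ring.
- move=> [sg k] t x /andP[st _] xr.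
  have comp (z : R -> 'rV[R]_d -> 'rV[R]_m) : zero_normal_derivative r (z t) ->
      h^-1 * (z t x 0 k - z t (x - h *: (r^-1 *: x)) 0 k) @[h --> 0^'+] --> (0 : R).
    move=> /(_ x xr) zN.
    have := cvg_comp _ _ zN (@coord_continuous R 1 m 0 k 0).
    rewrite mxE; apply: cvg_trans; apply: near_eq_cvg; near=> h.
    by rewrite /= !mxE.
  have -> : (fun h : R => h^-1 * (signed_sum u v (sg, k) t x -
       signed_sum u v (sg, k) t (x - h *: (r^-1 *: x)))) =
     (fun h : R => h^-1 * (v t x 0 k - v t (x - h *: (r^-1 *: x)) 0 k) +
       (-1) ^+ sg * (h^-1 * (u t x 0 k - u t (x - h *: (r^-1 *: x)) 0 k))).
    by apply/funext => h; rewrite /signed_sum/=; ring.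
  rewrite -[X in _ --> X]addr0 -[X in _ --> _ + X](mulr0 ((-1) ^+ sg)).
  apply: cvgD; first exact: comp (vN t st).
  by apply: cvgM; [exact: cvg_cst|exact: comp (uN t st)].
- move=> [sg k] x xr; rewrite /signed_sum/= v0// u0//.
  have := fg x k xr; rewrite ler_norml => /andP[fN fP].
  by case: sg; rewrite ?expr1 ?expr0 ?mulN1r ?mul1r; lra.
Unshelve. all: by end_near. Qed.

Unset Implicit Arguments.

Theorem proposition2p3 (R : realType) (d m : nat) (hd : (1 <= d)%N)
    (hm : (2 <= m)%N) (I : set R) (hI : right_halfline I)
    (Q : 'I_m -> R -> 'rV[R]_d -> 'M[R]_d)
    (b : 'I_m -> R -> 'rV[R]_d -> 'rV[R]_d)
    (C : R -> 'rV[R]_d -> 'M[R]_m)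
    (h_i : coef_Hoelder I Q b C)
    (h_ii : ellipticity I Q)
    (h_iii : lyapunov I Q b C)
    (h_iv : irreducible_coupling I C)
    (G GP : R -> R -> R -> ('rV[R]_d -> 'rV[R]_m) -> ('rV[R]_d -> 'rV[R]_m))
    (hG : forall r : R, 0 < r -> neumann_evolution I Q b C r (G r))
    (hGP : forall r : R, 0 < r ->
       neumann_evolution I Q b (offdiag_abs C) r (GP r)) :
  forall (s : R), I s -> forall (n : nat) (f : 'rV[R]_d -> 'rV[R]_m),
    continuous f -> bounded_fun f -> forall (j : 'I_m) (t : R), s < t ->
    forall x : 'rV[R]_d, oball n%:R x ->
      `|G n%:R t s f x 0 j| <= GP n%:R t s (fun y => abs_vec (f y)) x 0 j.
Proof.
move=> s Is n f fc _ j t st x xn.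
(* A point of the open ball of radius [n] excludes [n = 0]. *)
have n0 : 0 < n%:R :> R by exact: le_lt_trans (enorm_ge0 x) xn.
have uS := hG _ n0 s Is f (continuous_subspaceT fc).
have absfc : continuous (fun y => abs_vec (f y)).
  by move=> y; apply: continuous_comp; [exact: fc|exact: continuous_abs_vec].
have vS := hGP _ n0 s Is _ (continuous_subspaceT absfc).
have fabs y k : oball n%:R y -> `|f y 0 k| <= abs_vec (f y) 0 k.
  by rewrite mxE.
have [M wS] := signed_sum_cooperative_supersolution h_i h_ii
  (right_halfline_segment (t := t) hI Is) n0 uS vS fabs.
have stt : s <= t <= t by rewrite lexx ltW.
(* The minimum principle is applied with the final time [t] itself. *)
have wge0 sg := cooperative_supersolution_ge0 n0 wS (sg, j) stt (oball_cball xn).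
have := wge0 false; have := wge0 true; rewrite /signed_sum /= expr1 expr0.
by rewrite ler_norml => ? ?; lra.
Qed.
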